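(* Let $\ell$ and $m$ be integers with $2\le\ell<m$, let $G$ be an abelian group written additively, and let $\mathcal{A}=(A_1,\dots,A_m)$ be a sequence of finite subsets of $G$ with $|A_i|\ge2$ for each $i\in[1,m]$. Let $A=A_1\cup\cdots\cup A_m$ and $M=\{a\in A:\mu_{\mathcal{A}}(a)=\ell\}$. Assume \[ |\Sigma^{\ell}(\mathcal{A})|<\begin{cases}p(G)-1,&\ell=2,\\ p(G),&\ell\ge3.\end{cases} \] Then $|\Sigma^{\ell}(\mathcal{A})|=\sum_{a\in A}\mu_{\mathcal{A}}(a)-\ell+1$ if and only if $\mathcal{A}$ is an $(\ell,d)$-minimizing sequence of sets for some $d\in G$. Furthermore, if this equality holds, then: (1) if $\ell=2$, the sets $A_1\cup M,\dots,A_m\cup M$ are arithmetic progressions; (2) if $\ell\ge3$, the sets $A, A_1\cup M,\dots,A_m\cup M$ are arithmetic progressions with the same common difference.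
   Context: $p(G)$ is the order of the smallest nontrivial subgroup of $G$, or $\infty$ if no such (finite) subgroup exists. $\chi_S$ is the indicator function of $S$; $\mu_{\mathcal{A}}(a)=\min\big(\ell,\sum_{j=1}^m\chi_{A_j}(a)\big)$. $\Sigma^{\ell}(\mathcal{A})=\{a_{i_1}+\cdots+a_{i_\ell}: 1\le i_1<\cdots<i_\ell\le m,\ a_{i_j}\in A_{i_j}\}$. An arithmetic progression with common difference $d\neq0$ is $\{a+jd:j\in[0,k-1]\}$; an arithmetic progression of type $(a,d,b)$ is $\{a+jd+b:j\in[0,k-1]\}$, $d\ne0$. $\mathcal{A}$ is an $(\ell,d)$-minimizing sequence of sets if there exist $B_1,\dots,B_\ell\subseteq A$ with: (1) $|B_i|\ge2$; (2) $d\neq0$ and each $B_i$ is an arithmetic progression of type $(\alpha_i,d,\beta_i)$ with $\alpha_{i+1}=-\beta_i$ for $i\in[1,\ell-1]$; (3) $\mu_{\mathcal{A}}(a)=\sum_{j=1}^\ell\chi_{B_j}(a)$ for all $a\in A$; (4) $B_1+\cdots+B_\ell=\Sigma^{\ell}(\mathcal{A})$. *)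

(* Defs.v *)
From HB Require Import structures.
From mathcomp Require Import all_boot all_order all_algebra.
From mathcomp Require Import finmap.
Set Implicit Arguments. Unset Strict Implicit. Unset Printing Implicit Defensive.
Import GRing.Theory.
Local Open Scope ring_scope.
Local Open Scope fset_scope.

Section Defs.
Variable G : zmodType.

Definition fin_nontriv_subgroup (H : {fset G}) : Prop :=
  [/\ 0 \in H, (forall x y, x \in H -> y \in H -> x - y \in H) & (1 < #|` H|)%N].

(* "n < p(G)", where p(G) is the order of the smallest nontrivial finite
   subgroup of G, or infinity if there is none. *)
Definition lt_pG (n : nat) : Prop :=
  forall H : {fset G}, fin_nontriv_subgroup H -> (n < #|` H|)%N.

Definition fsetsum (X Y : {fset G}) : {fset G} := [fset (x + y)%R | x : G in X, y : G in Y].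

Definition bigsum (I : finType) (P : pred I) (F : I -> {fset G}) : {fset G} :=
  \big[fsetsum/[fset (0 : G)]]_(i | P i) F i.

Definition Sigma (m l : nat) (A : 'I_m -> {fset G}) : {fset G} :=
  \big[@fsetU G/fset0]_(I : {set 'I_m} | #|I| == l) bigsum (fun i => i \in I) A.

Definition Aunion (m : nat) (A : 'I_m -> {fset G}) : {fset G} :=
  \big[@fsetU G/fset0]_(i : 'I_m) A i.

Definition mu (m l : nat) (A : 'I_m -> {fset G}) (a : G) : nat :=
  minn l #|[set j : 'I_m | a \in A j]|.

Definition Mset (m l : nat) (A : 'I_m -> {fset G}) : {fset G} :=
  [fset a in Aunion A | mu l A a == l].

Definition is_AP (S : {fset G}) (d : G) : Prop :=
  d != 0 /\ exists (a : G) (k : nat), (0 < k)%N /\ S = [fset (a + d *+ j)%R | j in iota 0 k].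

Definition is_AP_type (S : {fset G}) (alpha d beta : G) : Prop :=
  d != 0 /\ exists k : nat, (0 < k)%N /\ S = [fset (alpha + d *+ j + beta)%R | j in iota 0 k].

(* A is an (l,d)-minimizing sequence of sets; B_1..B_l are indexed 0..l-1 *)
Definition minimizing (m l : nat) (d : G) (A : 'I_m -> {fset G}) : Prop :=
  exists (B : nat -> {fset G}) (alpha beta : nat -> G),
    [/\ (forall i, (i < l)%N -> B i `<=` Aunion A /\ (2 <= #|` B i|)%N),
        d != 0 /\ (forall i, (i < l)%N -> is_AP_type (B i) (alpha i) d (beta i))
          /\ (forall i, (i.+1 < l)%N -> alpha i.+1 = - beta i),
        (forall a, a \in Aunion A -> mu l A a = (\sum_(j < l) (a \in B j))%N)
      & bigsum xpredT (fun j : 'I_l => B j) = Sigma l A].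
End Defs.

(* Main.v *)
(* Only the differences of the progressions matter, so the proof works with
   "arcs": sets with at most one element x such that x - d lies outside; below
   p(G) the nonempty ones are exactly the progressions of difference d.  The
   Cauchy-Davenport bound and Vosper's theorem hold below p(G) by Dyson's
   e-transform.

   For any index i, put B_1 = A_i u M and recurse on the other sets with l - 1
   in place of l: this yields sets B_1, ..., B_l of size at least 2 that realize
   the truncated multiplicities mu and whose sumset lies in Sigma^l(A).
   Cauchy-Davenport then gives |Sigma^l(A)| >= sum mu - l + 1, and equality makes
   the B_j a tight system, hence arcs of a common difference by Vosper.  Since
   any index can come first, every A_i u M is an arc.

   For l >= 3, exchanging the first two indices keeps the remaining B_j, so all
   differences agree; replacing A_i, A_j by their union and intersection shows
   that A_i u A_j u M is an arc too, and then so is A, as two starting points of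
   A would be two starting points of some A_i u A_j u M. *)
Require Import Defs.
From HB Require Import structures.
From mathcomp Require Import all_boot all_order all_algebra perm.
From mathcomp Require Import finmap.
From mathcomp Require Import zify.
Import GRing.Theory.
Local Open Scope ring_scope.
Local Open Scope fset_scope.
Set Implicit Arguments. Unset Strict Implicit. Unset Printing Implicit Defensive.

(** * Sumsets below p(G) *)

(* [lia] only identifies cardinals up to syntactic equality, whereas rewriting
   may leave [G] seen as a type either directly or through its choice structure. *)
Ltac cardlia := intros; simpl Choice.sort in *; lia.

Section Sumsets.
Local Open Scope ring_scope.
Variable G : zmodType.
Implicit Types (S X Y Z P I : {fset G}) (d x y z : G).

Lemma lt_pGW n1 n2 : (n1 <= n2)%N -> lt_pG G n2 -> lt_pG G n1.
Proof. by move=> le12 lt2 H /lt2; apply: leq_ltn_trans. Qed.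

Lemma in_fsetsum X Y z :
  reflect (exists x y, [/\ x \in X, y \in Y & z = x + y]) (z \in fsetsum X Y).
Proof.
apply: (iffP (imfset2P _ _ _ _ _)) => [[x xX [y yY ->]]|[x [y [xX yY ->]]]].
  by exists x, y.
by exists x => //; exists y.
Qed.

Lemma mem_fsetsum X Y x y : x \in X -> y \in Y -> x + y \in fsetsum X Y.
Proof. by move=> xX yY; apply/in_fsetsum; exists x, y. Qed.

Lemma fsetsumC X Y : fsetsum X Y = fsetsum Y X.
Proof.
apply/fsetP => z; apply/in_fsetsum/in_fsetsum => -[x [y [xX yY ->]]];
by exists y, x; rewrite addrC.
Qed.

Lemma fsetsumA X Y Z : fsetsum X (fsetsum Y Z) = fsetsum (fsetsum X Y) Z.
Proof.
apply/fsetP => t; apply/in_fsetsum/in_fsetsum.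
  move=> [x [w [xX /in_fsetsum[y [z [yY zZ ->]]] ->]]].
  by exists (x + y), z; rewrite addrA mem_fsetsum.
move=> [w [z [/in_fsetsum[x [y [xX yY ->]]] zZ ->]]].
by exists x, (y + z); rewrite addrA mem_fsetsum.
Qed.

Lemma fsetsum0 X : fsetsum [fset 0] X = X.
Proof.
apply/fsetP => z; apply/in_fsetsum/idP => [[x [y [/fset1P -> yX ->]]]|zX].
  by rewrite add0r.
by exists 0, z; rewrite add0r fset11.
Qed.

Definition shift S d : {fset G} := [fset x + d | x in S].

Lemma in_shift S d z : (z \in shift S d) = (z - d \in S).
Proof.
apply/imfsetP/idP => [[x /= xS ->]|zS]; first by rewrite addrK.
by exists (z - d) => //; rewrite subrK.
Qed.

Lemma card_shift S d : #|` shift S d| = #|` S|.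
Proof. by rewrite card_imfset //=; apply: addIr. Qed.

Lemma fsetsum_shift X Y d : fsetsum X (shift Y d) = shift (fsetsum X Y) d.
Proof.
apply/fsetP => z; rewrite in_shift; apply/in_fsetsum/in_fsetsum.
  by move=> [x [y [xX]]]; rewrite in_shift => yY ->; exists x, (y - d); rewrite addrA.
move=> [x [y [xX yY zE]]]; exists x, (y + d).
by rewrite in_shift addrK addrA -zE subrK.
Qed.

Lemma card_fsetsumr X Y : (0 < #|` X|)%N -> (#|` Y| <= #|` fsetsum X Y|)%N.
Proof.
rewrite cardfs_gt0 => /fset0Pn[x xX].
rewrite -(card_shift Y x); apply: fsubset_leq_card; apply/fsubsetP => z.
by rewrite in_shift => zY; rewrite -(subrK x z) addrC mem_fsetsum.
Qed.

Lemma card_fsetsum_gt0 X Y :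
  (0 < #|` X|)%N -> (0 < #|` Y|)%N -> (0 < #|` fsetsum X Y|)%N.
Proof. by move=> X0 Y0; apply: leq_trans Y0 (card_fsetsumr _ X0). Qed.

(* The witness is the stabilizer of [S]. *)
Lemma periodic_large S d : (0 < #|` S|)%N -> d != 0 ->
  (forall x, x \in S -> x + d \in S) -> ~ lt_pG G #|` S|.
Proof.
rewrite cardfs_gt0 => /fset0Pn[s sS] d0 Sd ltS.
pose H := [fset h in shift S (- s) | shift S h == S].
have HE h : (h \in H) = (shift S h == S).
  rewrite !inE /= in_shift opprK andb_idl // => /eqP Sh.
  by rewrite addrC -Sh in_shift addrK.
have shiftD x y : shift S (x + y) = shift (shift S x) y.
  by apply/fsetP => z; rewrite !in_shift opprD addrA addrAC.
have shift0 : shift S 0 = S by apply/fsetP => z; rewrite in_shift subr0.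
have H0 : 0 \in H by rewrite HE shift0.
have Hd : d \in H.
  rewrite HE eq_sym eqEfcard card_shift leqnn andbT.
  suff /eqP -> : shift S d == S by [].
  rewrite eqEfcard card_shift leqnn andbT; apply/fsubsetP => z.
  by rewrite in_shift => /Sd; rewrite subrK.
have /ltS : fin_nontriv_subgroup H.
  split=> //.
    move=> x y; rewrite !HE => /eqP Hx /eqP Hy.
    by rewrite -{1}Hy -shiftD [y + _]addrC subrK Hx.
  have /fsubset_leq_card : [fset 0; d] `<=` H.
    by apply/fsubsetP => z /fset2P[] ->.
  by rewrite cardfs2 eq_sym d0.
rewrite ltnNge; apply/negP/negPn.
rewrite -[leqRHS](card_shift S (- s)) fsubset_leq_card //.
exact: fset_sub.
Qed.

(** Induction on the size of [Y] by Dyson's e-transform: [X'], the union of [X] and [Y + e], and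
    [Y'], the intersection of [Y] and [X - e], keep the total size, and their sumset stays inside
    [X + Y]. *)
Lemma Cauchy_Davenport X Y : (0 < #|` X|)%N -> (0 < #|` Y|)%N ->
  lt_pG G #|` fsetsum X Y| -> (#|` X| + #|` Y| <= #|` fsetsum X Y| + 1)%N.
Proof.
move: {2}#|`Y|.+1 (ltnSn #|` Y|) => n; elim: n X Y => // n IHn X Y.
rewrite ltnS => leYn X0 Y0.
have [y0 y0Y] := fset0Pn _ (introT idP (etrans (esym (cardfs_gt0 Y)) Y0)).
wlog Y00 : Y leYn Y0 {y0 y0Y} / 0 \in Y => [hw|] ltXY.
  have := hw (shift Y (- y0)); rewrite fsetsum_shift !card_shift in_shift.
  by rewrite opprK add0r; apply.
have sXXY : X `<=` fsetsum X Y.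
  by apply/fsubsetP => x xX; rewrite -[x]addr0 mem_fsetsum.
have [Y1|Y2] := leqP #|` Y| 1.
  by have := fsubset_leq_card sXXY; lia.
have [y yY y_neq0] : exists2 y, y \in Y & y != 0.
  have : (0 < #|` Y `\ 0%R|)%N by move: Y2; rewrite (cardfsD1 0) Y00 add1n ltnS.
  by rewrite cardfs_gt0 => /fset0Pn[y]; rewrite !inE => /andP[? ?]; exists y.
(* If [X + y] stayed inside [X], the set would be periodic, hence too large. So some [e + w] leaves
   [X]; then [w] drops out of [Y'] and the induction advances. *)
have [e eX [w wY ewX]] : exists2 e, e \in X & exists2 w, w \in Y & e + w \notin X.
  have /fsubsetPn[e] : ~~ (shift X y `<=` X).
    apply/negP => /fsubsetP sX; apply: (@periodic_large X y) => //.
      by move=> x xX; apply: sX; rewrite in_shift addrK.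
    by apply: lt_pGW ltXY; apply: fsubset_leq_card.
  rewrite in_shift => eX eNX; exists (e - y) => //.
  by exists y => //; rewrite subrK.
pose X' := X `|` shift Y e; pose Y' := Y `&` shift X (- e).
have sub : fsetsum X' Y' `<=` fsetsum X Y.
  apply/fsubsetP => z /in_fsetsum[x [v [+ + ->]]].
  rewrite !inE !in_shift opprK => /orP[xX /andP[vY _]|xY /andP[_ vX]].
    exact: mem_fsetsum.
  have -> : x + v = (v + e) + (x - e) by rewrite addrACA subrr addr0 addrC.
  exact: mem_fsetsum.
have cardE : (#|` X'| + #|` Y'| = #|` X| + #|` Y|)%N.
  rewrite -(card_shift Y e) -(cardfsUI X (shift Y e)); congr (_ + _)%N.
  rewrite -(card_shift Y' e); congr (#|` _|); apply/fsetP => z.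
  by rewrite in_shift !inE !in_shift opprK subrK andbC.
have Y'0 : 0 \in Y' by rewrite !inE Y00 in_shift opprK add0r.
have ltY' : (#|` Y'| < #|` Y|)%N.
  rewrite (cardfsD1 w Y) wY ltnS fsubset_leq_card //; apply/fsubsetP => z.
  rewrite !inE in_shift opprK => /andP[-> zX]; rewrite andbT.
  by apply: contraNneq ewX => <-; rewrite addrC.
rewrite -cardE.
apply: leq_trans (_ : #|` fsetsum X' Y'| + 1 <= _)%N; last first.
  by rewrite leq_add2r fsubset_leq_card.
apply: IHn; first by lia.
- by rewrite cardfs_gt0; apply/fset0Pn; exists e; rewrite !inE eX.
- by rewrite cardfs_gt0; apply/fset0Pn; exists 0.
- exact: lt_pGW (fsubset_leq_card sub) ltXY.
Qed.

End Sumsets.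

(** * Arcs and Vosper's theorem *)

Section Arcs.
Local Open Scope ring_scope.
Variable G : zmodType.
Implicit Types (S X Y Z P I : {fset G}) (d x y z : G).

Definition arc d S : Prop :=
  forall x y, x \in S -> y \in S -> x - d \notin S -> y - d \notin S -> x = y.

(** Without a starting point, [S] would be closed under subtracting [d], hence too large to lie
    below p(G). *)
Lemma start_exists d S : lt_pG G #|` S| -> (0 < #|` S|)%N -> d != 0 ->
  exists2 x, x \in S & x - d \notin S.
Proof.
move=> ltS S0 d0.
have /fsubsetPn[x xS xdS] : ~~ (S `<=` shift S d).
  apply/negP => /fsubsetP sS; apply: (@periodic_large _ S (- d)) => //.
    by rewrite oppr_eq0.
  by move=> x /sS; rewrite in_shift.
by exists x; rewrite // -in_shift.
Qed.

Lemma arc_shift d S e : arc d S -> arc d (shift S e).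
Proof.
move=> aS x y; rewrite !in_shift ![_ - d - e]addrAC => xS yS xdS ydS.
by apply: (addIr (- e)); apply: aS.
Qed.

(** A starting point of the sumset is a sum of starting points, since stepping back by [d] in either
    summand would stay in the sumset. *)
Lemma arc_sum d X Y : arc d X -> arc d Y -> arc d (fsetsum X Y).
Proof.
move=> aX aY s t /in_fsetsum[x [y [xX yY ->]]] /in_fsetsum[x' [y' [x'X y'Y ->]]].
have notin u v : u \in X -> v \in Y -> u + v - d \notin fsetsum X Y ->
    u - d \notin X /\ v - d \notin Y.
  move=> uX vY N; split; apply: contra N => H; first by rewrite addrAC mem_fsetsum.
  by rewrite -addrA mem_fsetsum.
move=> Nxy Nxy'; have [Nx Ny] := notin _ _ xX yY Nxy.
have [Nx' Ny'] := notin _ _ x'X y'Y Nxy'.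
by rewrite (aX _ _ xX x'X Nx Nx') (aY _ _ yY y'Y Ny Ny').
Qed.

Lemma card_shiftU d S : (#|` S `|` shift S d| = #|` S| + #|` S `\` shift S d|)%N.
Proof.
have := cardfsUI S (shift S d); have := cardfsID (shift S d) S.
by rewrite card_shift; cardlia.
Qed.

(** The starting points form the difference of [S] and [S + d], so counting them turns being an arc
    into a cardinality bound that Cauchy-Davenport can deliver. *)
Lemma arcP d S : reflect (arc d S) (#|` S `|` shift S d| <= #|` S| + 1)%N.
Proof.
rewrite card_shiftU leq_add2l.
have inD x : (x \in S `\` shift S d) = (x - d \notin S) && (x \in S).
  by rewrite inE in_shift.
apply: (iffP idP) => [le1 x y xS yS xdS ydS|aS].
  have : [fset x; y] `<=` S `\` shift S d.
    by apply/fsubsetP => z /fset2P[] ->; rewrite inD ?xS ?xdS ?yS ?ydS.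
  move=> /fsubset_leq_card; rewrite cardfs2; case: eqVneq => //= _.
  by move=> le2; have := leq_trans le2 le1.
have [->|/fset0Pn[x]] := eqVneq (S `\` shift S d) fset0; first by rewrite cardfs0.
rewrite inD => /andP[xdS xS].
rewrite -(cardfs1 x) fsubset_leq_card //; apply/fsubsetP => y.
by rewrite inD in_fset1 => /andP[ydS yS]; apply/eqP/aS.
Qed.

Lemma card_shiftU_gt d S : lt_pG G #|` S| -> (0 < #|` S|)%N -> d != 0 ->
  (#|` S| < #|` S `|` shift S d|)%N.
Proof.
move=> ltS S0 d0; have [x xS xdS] := start_exists ltS S0 d0.
rewrite card_shiftU -addn1 leq_add2l cardfs_gt0; apply/fset0Pn; exists x.
by rewrite inE in_shift xS xdS.
Qed.

(** [V], the elements of [X] whose successor is also in [X], misses at most one element of [X].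
    Adding [V] to the union of [Y] and [Y + d] stays in [X + Y], so Cauchy-Davenport lets that union
    exceed [Y] by at most one. *)
Lemma arc_propagate d X Y : d != 0 -> arc d X -> (2 <= #|` X|)%N ->
  (0 < #|` Y|)%N -> lt_pG G #|` fsetsum X Y| ->
  (#|` fsetsum X Y| + 1 <= #|` X| + #|` Y|)%N -> arc d Y.
Proof.
move=> d0 aX X2 Y0 ltXY tight; apply/arcP.
pose V := X `&` shift X (- d).
have VE x : (x \in V) = (x \in X) && (x + d \in X) by rewrite inE in_shift opprK.
have cardV : (#|` X| <= #|` V| + 1)%N.
  have /arcP := aX; have := cardfsUI X (shift X d); rewrite card_shift.
  have -> : X `&` shift X d = shift V d.
    by apply/fsetP => x; rewrite in_shift VE inE in_shift subrK andbC.
  rewrite card_shift; cardlia.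
have sub : fsetsum V (Y `|` shift Y d) `<=` fsetsum X Y.
  apply/fsubsetP => z /in_fsetsum[v [y [+ + ->]]]; rewrite VE => /andP[vX vdX].
  rewrite inE in_shift => /orP[yY|yY]; first exact: mem_fsetsum.
  by rewrite -[y](subrK d) addrA addrAC mem_fsetsum.
have leU := fsubset_leq_card sub.
have YU : (#|` Y| <= #|` Y `|` shift Y d|)%N by rewrite fsubset_leq_card // fsubsetUl.
have := @Cauchy_Davenport _ V (Y `|` shift Y d).
have ltU := lt_pGW leU ltXY.
move=> /(_ _ _ ltU); cardlia.
Qed.

(* If [X] switches to [Z] at [z], then [z + P] lies in the arc
   [S `|` (S + d)] for [S = X + Z], so Cauchy-Davenport leaves no room for
   such a [z] outside [I `|` (I + d)]. *)
Lemma arc_of_setUI_start d X Z (P := X `|` Z) (I := X `&` Z) :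
    d != 0 -> arc d P -> arc d I -> (0 < #|` I|)%N ->
    lt_pG G #|` fsetsum X Z|.+1 ->
    (#|` fsetsum X Z| + 1 <= #|` X| + #|` Z|)%N ->
  forall x, x \in X -> x - d \notin X -> x - d \in Z -> x \in I.
Proof.
move=> d0 aP aI I0 ltS tight x xX xdX xdZ.
set S := fsetsum X Z in ltS tight *.
have cPI : (#|` P| + #|` I| = #|` X| + #|` Z|)%N by rewrite cardfsUI.
have sPI : fsetsum P I `<=` S.
  apply/fsubsetP => t /in_fsetsum[u [v [+ + ->]]]; rewrite !inE => uP /andP[vX vZ].
  by case/orP: uP => [uX|uZ]; [|rewrite addrC]; apply: mem_fsetsum.
have P0 : (0 < #|` P|)%N.
  by apply: leq_trans I0 (fsubset_leq_card _); rewrite fsubIset ?fsubsetUl.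
have leS := fsubset_leq_card sPI.
have SE : fsetsum P I = S.
  apply/eqP; rewrite eqEfcard sPI /=.
  have := Cauchy_Davenport P0 I0 (lt_pGW (leqW leS) ltS); cardlia.
have /arcP aS : arc d S by rewrite -SE; apply: arc_sum.
set T := S `|` shift S d in aS.
have ltT : lt_pG G #|` T| by apply: lt_pGW ltS; rewrite -addn1.
set J := (I `|` shift I d) `|` [fset x].
(* For the extra point [x]: if [u] is in [X], then [u + (x - d)] is in [S] because [x - d] is in
   [Z]; if [u] is in [Z], then [u + x] is in [S] directly. *)
have subJ : fsetsum P J `<=` T.
  apply/fsubsetP => t /in_fsetsum[u [v [uP + ->]]]; rewrite !inE !in_shift.
  move=> /orP[/orP[vI|vI]|/eqP->].
  - by apply/orP; left; rewrite -SE mem_fsetsum // inE.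
  - by apply/orP; right; rewrite -SE -addrA mem_fsetsum // inE.
  - move: uP; rewrite inE => /orP[uX|uZ]; apply/orP; [right|left].
      by rewrite -addrA mem_fsetsum.
    by rewrite addrC mem_fsetsum.
have leT := fsubset_leq_card subJ.
have J0 : (0 < #|` J|)%N.
  by rewrite cardfs_gt0; apply/fset0Pn; exists x; rewrite !inE eqxx orbT.
have cdJ := Cauchy_Davenport P0 J0 (lt_pGW leT ltT).
have ltI : lt_pG G #|` I|.
  apply: lt_pGW ltS; apply: leqW; apply: leq_trans leS.
  by apply: card_fsetsumr.
have gtI := card_shiftU_gt ltI I0 d0.
have xI : x \in I `|` shift I d.
  apply: contraTT isT => xNI.
  have : #|` J| = (#|` I `|` shift I d| + 1)%N.
    by rewrite /J fsetUC cardfsU1 xNI addnC.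
  rewrite -/T in aS; cardlia.
by move: xI; rewrite inE in_shift => /orP[//|]; rewrite inE (negPf xdX).
Qed.

(** A starting point [x] of [X] is of one of two kinds: if [x - d] lies in [Z], it is a starting
    point of the intersection; otherwise of the union. Each kind occurs at most once, and [key]
    excludes having one of each. *)
Lemma arc_of_setUI d X Z :
    d != 0 -> arc d (X `|` Z) -> arc d (X `&` Z) -> (0 < #|` X `&` Z|)%N ->
    lt_pG G #|` fsetsum X Z|.+1 ->
    (#|` fsetsum X Z| + 1 <= #|` X| + #|` Z|)%N -> arc d X.
Proof.
move=> d0 aP aI I0 ltS tight.
have ZXS := fsetsumC Z X; have ZXU := fsetUC Z X; have ZXI := fsetIC Z X.
have stX := arc_of_setUI_start d0 aP aI I0 ltS tight.
have stZ : forall x, x \in Z -> x - d \notin Z -> x - d \in X -> x \in X `&` Z.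
  rewrite -ZXI; apply: arc_of_setUI_start; rewrite ?ZXS ?ZXU ?ZXI //.
  by rewrite [leqRHS]addnC.
have Z0 : (0 < #|` Z|)%N.
  by apply: leq_trans I0 (fsubset_leq_card _); apply: fsubsetIr.
have X0 : (0 < #|` X|)%N.
  by apply: leq_trans I0 (fsubset_leq_card _); apply: fsubsetIl.
have [s sZ sdZ] : exists2 s, s \in Z & s - d \notin Z.
  apply: start_exists => //; apply: lt_pGW ltS; apply: leqW.
  by apply: card_fsetsumr.
(* Compare with a starting point [s] of [Z]. If [s - d] were in [X], then [s] would start the
   intersection, forcing [s = y], which is absurd; so [s] starts the union, [s = x], and [x] starts
   the intersection together with [y]. *)
have key x y : x \in X -> x - d \notin X -> x - d \notin Z ->
    y \in X -> y - d \notin X -> y - d \in Z -> x = y.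
  move=> xX xdX xdZ yX ydX ydZ.
  have yI := stX _ yX ydX ydZ.
  have sdX : s - d \notin X.
    apply/negP => sdX; have sI := stZ _ sZ sdZ sdX.
    have sy : s = y by apply: aI => //; rewrite inE ?(negPf sdZ) ?(negPf ydX) ?andbF.
    by rewrite sy (negPf ydX) in sdX.
  have xs : x = s.
    by apply: aP; rewrite !inE ?xX ?sZ ?orbT ?negb_or ?xdX ?xdZ ?sdX ?sdZ.
  have xI : x \in X `&` Z by rewrite inE xX xs sZ.
  by apply: aI => //; rewrite inE ?(negPf xdX) ?(negPf ydX).
move=> x y xX yX xdX ydX.
have [xdZ|xdZ] := boolP (x - d \in Z); have [ydZ|ydZ] := boolP (y - d \in Z).
- by apply: aI; [exact: stX|exact: stX|rewrite inE (negPf xdX)|rewrite inE (negPf ydX)].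
- by apply/esym/key.
- exact: key.
- by apply: aP; rewrite !inE ?xX ?yX // negb_or ?xdX ?ydX.
Qed.

(** Induction on the size of [Y], translated to contain 0. If some e-transform leaves a proper part
    of [Y] with at least two elements, the transformed sets are arcs by induction, and arcs are
    recovered for [X], then for [Y]. Otherwise [Y] turns out to have two elements. *)
Lemma Vosper X Y : (2 <= #|` X|)%N -> (2 <= #|` Y|)%N ->
    lt_pG G #|` fsetsum X Y|.+1 -> (#|` fsetsum X Y| + 1 <= #|` X| + #|` Y|)%N ->
  exists d, [/\ d != 0, arc d X & arc d Y].
Proof.
move: {2}#|`Y|.+1 (ltnSn #|` Y|) => n; elim: n X Y => // n IHn X Y.
rewrite ltnS => leYn X2 Y2.
have [y0 y0Y] : exists y, y \in Y by apply/fset0Pn; rewrite -cardfs_gt0; cardlia.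
wlog Y00 : Y leYn Y2 {y0 y0Y} / 0 \in Y => [hw ltS tight|ltS tight].
  have [|||||d [d0 aX aY]] := hw (shift Y (- y0)).
  - by rewrite card_shift.
  - by rewrite card_shift.
  - by rewrite in_shift opprK add0r.
  - by rewrite fsetsum_shift card_shift.
  - by rewrite fsetsum_shift !card_shift.
  exists d; split=> //; have := @arc_shift _ _ y0 aY.
  suff -> : shift (shift Y (- y0)) y0 = Y by [].
  by apply/fsetP => z; rewrite !in_shift opprK subrK.
have ltS' := lt_pGW (leqnSn _) ltS.
have leXS : (#|` X| <= #|` fsetsum X Y|)%N by rewrite fsetsumC card_fsetsumr //; cardlia.
have leYS : (#|` Y| <= #|` fsetsum X Y|)%N by rewrite card_fsetsumr //; cardlia.
pose YX e := Y `&` shift X (- e).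
have inYX e y : (y \in YX e) = (y \in Y) && (y + e \in X).
  by rewrite inE in_shift opprK.
have [/existsP[[e eX] /= /andP[Y'2 ltY']]|/existsPn noE] :=
  boolP [exists e : X, (1 < #|` YX (val e)|)%N && (#|` YX (val e)| < #|` Y|)%N].
  pose Z := shift Y e; pose P := X `|` Z.
  have sub : fsetsum P (YX e) `<=` fsetsum X Y.
    apply/fsubsetP => z /in_fsetsum[x [v [+ + ->]]].
    rewrite inYX inE in_shift => /orP[xX /andP[vY _]|xY /andP[_ vX]].
      exact: mem_fsetsum.
    have -> : x + v = (v + e) + (x - e) by rewrite addrACA subrr addr0 addrC.
    exact: mem_fsetsum.
  have IE : X `&` Z = shift (YX e) e.
    by apply/fsetP => z; rewrite in_shift inYX inE in_shift subrK andbC.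
  have cardE : (#|` P| + #|` YX e| = #|` X| + #|` Y|)%N.
    by rewrite -(card_shift Y e) -(cardfsUI X Z) IE card_shift.
  have leU := fsubset_leq_card sub.
  have P2 : (2 <= #|` P|)%N by apply: leq_trans X2 (fsubset_leq_card _); apply: fsubsetUl.
  have [|||d [d0 aP aI]] := IHn P (YX e) _ P2 Y'2.
  - cardlia.
  - by apply: lt_pGW ltS.
  - cardlia.
  have SE : fsetsum X Z = shift (fsetsum X Y) e by rewrite fsetsum_shift.
  have aX : arc d X.
    apply: (@arc_of_setUI d X Z); rewrite ?SE ?IE ?card_shift //; last by cardlia.
    exact: arc_shift aI.
  exists d; split=> //.
  by apply: (arc_propagate d0 aX) => //; cardlia.
(* In the remaining case each [YX e] with [e] in [X] is either [{0}] or all of [Y]; [E] collects the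
   second kind. *)
pose E := [fset e in X | Y `<=` YX e].
have YX1 e : e \in X -> e \notin E -> YX e = [fset 0].
  move=> eX; rewrite !inE /= eX /= => eE.
  have := noE [` eX]; rewrite negb_and -!leqNgt => /orP[le1|leY].
    have Y'0 : 0 \in YX e by rewrite inYX Y00 add0r.
    by apply/esym/eqP; rewrite eqEfcard fsub1set Y'0 cardfs1.
  by move: eE; rewrite -(_ : YX e = Y) ?fsubset_refl //; apply/eqP; rewrite eqEfcard leY fsubsetIl.
pose Y1 := Y `\ 0.
have cY1 : (#|` Y| = #|` Y1| + 1)%N by rewrite (cardfsD1 0) Y00 addnC.
pose D := fsetsum X Y `\` X.
have sXS : X `<=` fsetsum X Y.
  by apply/fsubsetP => x xX; rewrite -[x]addr0 mem_fsetsum.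
have cD : (#|` D| <= #|` Y1|)%N.
  have := cardfsDS sXS; rewrite -/D; cardlia.
have DE e : e \in X -> e \notin E -> shift Y1 e = D.
  move=> eX eE; apply/eqP; rewrite eqEfcard card_shift cD andbT.
  apply/fsubsetP => z; rewrite in_shift !inE => /andP[ze0 zeY].
  rewrite -{2}(subrK e z) addrC mem_fsetsum // andbT.
  apply: contra ze0 => zX; rewrite -in_fset1 -(YX1 e eX eE) inYX zeY.
  by rewrite subrK.
(* At most one element of [X] lies outside [E]: two of them, [e] and [f], would give
   [Y1 + e = D = Y1 + f], making [Y1] periodic with period [f - e]. *)
have cXE : (#|` X| <= #|` E| + 1)%N.
  have -> : #|` X| = (#|` E| + #|` X `\` E|)%N.
    by rewrite cardfsDS ?fset_sub // addnC subnK // fsubset_leq_card // fset_sub.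
  rewrite leq_add2l.
  have [->|/fset0Pn[e]] := eqVneq (X `\` E) fset0; first by rewrite cardfs0.
  rewrite inE => /andP[eE eX]; rewrite -(cardfs1 e) fsubset_leq_card //.
  apply/fsubsetP => f; rewrite inE in_fset1 => /andP[fE fX].
  apply: contraTT isT => fe.
  have Y10 : (0 < #|` Y1|)%N by cardlia.
  have fe0 : f - e != 0 by rewrite subr_eq0.
  exfalso; apply: (periodic_large Y10 fe0) => [x xY|].
    have : x + f \in D by rewrite -(DE f fX fE) in_shift addrK.
    by rewrite -(DE e eX eE) in_shift addrA.
  by apply: lt_pGW ltS; cardlia.
(* [E + Y] fits into [X], which has at most one element more than [E], so Cauchy-Davenport leaves
   only two elements for [Y]: 0 and the difference [d]. *)
have Y2E : #|` Y1| = 1%N.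
  apply/eqP; rewrite eqn_leq; apply/andP; split; last by cardlia.
  have E0 : (0 < #|` E|)%N by cardlia.
  have sEY : fsetsum E Y `<=` X.
    apply/fsubsetP => z /in_fsetsum[e [y [+ yY ->]]]; rewrite !inE /=.
    by move=> /andP[eX /fsubsetP /(_ y yY)]; rewrite inYX addrC => /andP[].
  have leE := fsubset_leq_card sEY.
  have Y0 : (0 < #|` Y|)%N by cardlia.
  have := Cauchy_Davenport E0 Y0 (lt_pGW (leq_trans leE leXS) ltS').
  cardlia.
have /cardfs1P[d Y1E] : #|` Y1| == 1%N by rewrite Y2E.
have dY : d \in Y1 by rewrite Y1E fset11.
have [d0 dYY] : d != 0 /\ d \in Y by move: dY; rewrite !inE => /andP[].
have YE : Y = [fset 0; d] by rewrite -Y1E /Y1 fsetD1K.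
have aY : arc d Y.
  move=> x y; rewrite YE !inE => xY yY xdY ydY.
  have E0 z : (z == 0) || (z == d) -> ~~ ((z - d == 0) || (z - d == d)) -> z = 0.
    by case/orP => /eqP-> //; rewrite subrr eqxx.
  by rewrite (E0 x xY xdY) (E0 y yY ydY).
exists d; split=> //.
apply: (arc_propagate d0 aY) => //; rewrite 1?fsetsumC //; cardlia.
Qed.

End Arcs.

(** * Arithmetic progressions and tight sequences of sets *)

Section Progressions.
Local Open Scope ring_scope.
Variable G : zmodType.
Implicit Types (S X Y : {fset G}) (Bs : seq {fset G}) (d x y a : G).

Local Notation prog a d k := [fset (a + d *+ j)%R | j in iota 0 k].

Lemma progP a d k x :
  reflect (exists2 j, (j < k)%N & x = a + d *+ j) (x \in prog a d k).
Proof.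
apply: (iffP (imfsetP _ _ _ _)) => -[j /= jk ->]; exists j => //.
  by rewrite mem_iota in jk.
by rewrite mem_iota.
Qed.

Lemma card_prog_le a d k : (#|` prog a d k| <= k)%N.
Proof.
apply: leq_trans (leq_imfset_card _ _ _) _.
by rewrite -[leqRHS](size_iota 0) /= size_undup.
Qed.

Lemma arc_prog a d k : arc d (prog a d k).
Proof.
have start x : x \in prog a d k -> x - d \notin prog a d k -> x = a.
  move=> /progP[[|j] jk ->] => [|/negP[]]; first by rewrite mulr0n addr0.
  by apply/progP; exists j; rewrite ?(ltnW jk) // mulrSr addrA addrK.
by move=> x y xS yS xdS ydS; rewrite (start x xS xdS) (start y yS ydS).
Qed.

(** Peel off the starting point [s]: any starting point of the rest other than [s + d] would be a
    second one of [S], so the rest is an arc and its progression begins at [s + d]. *)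
Lemma prog_arc d S : d != 0 -> arc d S -> (0 < #|` S|)%N -> lt_pG G #|` S| ->
  exists a, S = prog a d #|` S|.
Proof.
move=> d0; move: {2}#|` S| (erefl #|` S|) => n; elim: n S => [|n IHn] S Sn aS S0 ltS.
  by rewrite Sn in S0.
have [s sS sdS] := start_exists ltS S0 d0; exists s.
have cS : #|` S `\ s| = n by have := cardfsD1 s S; rewrite sS Sn add1n => -[].
have [n0|n_gt0] := posnP n.
  have S1 : S `\ s = fset0 by apply: cardfs0_eq; rewrite cS n0.
  rewrite Sn n0 -(fsetD1K sS) S1 fsetU0; apply/fsetP => x; rewrite in_fset1.
  apply/eqP/progP => [->|[[|//] _ ->]]; last by rewrite mulr0n addr0.
  by exists 0%N; rewrite ?mulr0n ?addr0.
have ltS1 : lt_pG G #|` S `\ s| by apply: lt_pGW ltS; rewrite cS Sn.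
have S10 : (0 < #|` S `\ s|)%N by rewrite cS.
have startE x : x \in S `\ s -> x - d \notin S `\ s -> x = s + d.
  rewrite !inE => /andP[xs xS]; rewrite negb_and negbK => /orP[/eqP<-|xdS].
    by rewrite subrK.
  by rewrite (aS _ _ xS sS xdS sdS) eqxx in xs.
have aS1 : arc d (S `\ s).
  by move=> x y xS yS xdS ydS; rewrite (startE x xS xdS) (startE y yS ydS).
have [a S1E] := IHn _ cS aS1 S10 ltS1.
have aE : a = s + d.
  have [t tS tdS] := start_exists ltS1 S10 d0.
  rewrite -(startE t tS tdS); move: tS tdS; rewrite S1E.
  move=> /progP[[|j] jn ->]; rewrite ?mulr0n ?addr0 // => /negP[].
  by apply/progP; exists j; rewrite ?(ltnW jn) // mulrSr addrA addrK.
rewrite Sn; apply/fsetP => x; rewrite -(fsetD1K sS) S1E cS aE !inE.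
apply/orP/progP => [[/eqP->|/progP[j jn ->]]|[[|j] jn ->]].
- by exists 0%N; rewrite ?mulr0n ?addr0.
- by exists j.+1; rewrite // mulrS addrA.
- by left; rewrite mulr0n addr0.
- by right; apply/progP; exists j; rewrite // mulrS addrA.
Qed.

(** The converse bound to Cauchy-Davenport: the sum of two progressions lies in one of length
    [#|X| + #|Y| - 1]. *)
Lemma card_fsetsum_arcs d X Y : d != 0 -> arc d X -> arc d Y ->
    (0 < #|` X|)%N -> (0 < #|` Y|)%N -> lt_pG G #|` fsetsum X Y| ->
  (#|` fsetsum X Y| + 1 <= #|` X| + #|` Y|)%N.
Proof.
move=> d0 aX aY X0 Y0 ltXY.
have leX : (#|` X| <= #|` fsetsum X Y|)%N by rewrite fsetsumC card_fsetsumr.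
have [a XE] := prog_arc d0 aX X0 (lt_pGW leX ltXY).
have [b YE] := prog_arc d0 aY Y0 (lt_pGW (card_fsetsumr Y X0) ltXY).
suff /fsubset_leq_card : fsetsum X Y `<=` prog (a + b) d (#|` X| + #|` Y|).-1.
  by move=> /leq_trans /(_ (card_prog_le _ _ _)); cardlia.
apply/fsubsetP => z /in_fsetsum[x [y []]].
rewrite {1}XE {1}YE => /progP[i iX ->] /progP[j jY ->] ->.
apply/progP; exists (i + j)%N; first by cardlia.
by rewrite mulrnDr addrACA.
Qed.

Lemma is_AP_arc d S : is_AP S d -> arc d S.
Proof. by move=> [_ [a [k [_ ->]]]]; apply: arc_prog. Qed.

Lemma arc_is_AP d S : d != 0 -> arc d S -> (0 < #|` S|)%N -> lt_pG G #|` S| ->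
  is_AP S d.
Proof.
move=> d0 aS S0 ltS; have [a SE] := prog_arc d0 aS S0 ltS.
by split=> //; exists a, #|` S|.
Qed.

Lemma is_AP_typeP S a d b : is_AP_type S a d b -> is_AP S d.
Proof.
move=> [d0 [k [k0 ->]]]; split=> //; exists (a + b), k; split=> //.
by apply: eq_imfset => // j; rewrite addrAC.
Qed.

HB.instance Definition _ :=
  Monoid.isComLaw.Build {fset G} [fset 0] (@fsetsum G)
    (@fsetsumA G) (@fsetsumC G) (@fsetsum0 G).

Definition sumset Bs : {fset G} := \big[@fsetsum G/[fset 0]]_(B <- Bs) B.

Lemma sumset_cons X Bs : sumset (X :: Bs) = fsetsum X (sumset Bs).
Proof. by rewrite /sumset big_cons. Qed.

Lemma perm_sumset Bs1 Bs2 : perm_eq Bs1 Bs2 -> sumset Bs1 = sumset Bs2.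
Proof. exact: perm_big. Qed.

Local Notation nonempty := (fun B : {fset G} => 0 < #|` B|)%N.
Local Notation nontrivial := (fun B : {fset G} => 1 < #|` B|)%N.

Lemma card_sumset_gt0 Bs : all nonempty Bs -> (0 < #|` sumset Bs|)%N.
Proof.
elim: Bs => [|B Bs IHB] /=; first by rewrite /sumset big_nil cardfs1.
by rewrite sumset_cons => /andP[B0 /IHB]; apply: card_fsetsum_gt0.
Qed.

Lemma Cauchy_Davenport_seq Bs : all nonempty Bs -> lt_pG G #|` sumset Bs| ->
  (\sum_(B <- Bs) #|` B| + 1 <= #|` sumset Bs| + size Bs)%N.
Proof.
elim: Bs => [|B Bs IHB] /=; first by rewrite /sumset !big_nil cardfs1.
rewrite sumset_cons big_cons => /andP[B0 Bs0] ltS.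
have Sum0 := card_sumset_gt0 Bs0.
have := IHB Bs0 (lt_pGW (card_fsetsumr _ B0) ltS).
have := Cauchy_Davenport B0 Sum0 ltS.
cardlia.
Qed.

Lemma card_sumset_arcs d Bs : d != 0 -> all nonempty Bs ->
    (forall B, B \in Bs -> arc d B) -> lt_pG G #|` sumset Bs| ->
  (#|` sumset Bs| + size Bs <= \sum_(B <- Bs) #|` B| + 1)%N.
Proof.
move=> d0.
(* The induction must also carry that the sumset is itself an arc, for the two-set bound to
   apply. *)
suff H : all nonempty Bs -> (forall B, B \in Bs -> arc d B) ->
    lt_pG G #|` sumset Bs| -> arc d (sumset Bs) /\
  (#|` sumset Bs| + size Bs <= \sum_(B <- Bs) #|` B| + 1)%N.
  by move=> Bs0 aBs /(H Bs0 aBs)[].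
elim: Bs => [|B Bs IHB] /=.
  rewrite /sumset !big_nil cardfs1; split=> // x y.
  by rewrite !inE => /eqP-> /eqP->.
rewrite sumset_cons big_cons => /andP[B0 Bs0] aBs ltS.
have Sum0 := card_sumset_gt0 Bs0.
have aB : arc d B by apply: aBs; rewrite inE eqxx.
have aBs' C : C \in Bs -> arc d C by move=> CBs; apply: aBs; rewrite inE CBs orbT.
have [aS leS] := IHB Bs0 aBs' (lt_pGW (card_fsetsumr _ B0) ltS).
have := card_fsetsum_arcs d0 aB aS B0 Sum0 ltS.
split; [exact: arc_sum|cardlia].
Qed.

(** Any excess in [X + Y] would survive Cauchy-Davenport against the other members and break the
    total. The second bound later keeps [X + Y] far enough below p(G). *)
Lemma tight_pair Bs X Y R : all nonempty Bs -> perm_eq Bs (X :: Y :: R) ->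
    lt_pG G #|` sumset Bs| ->
    (#|` sumset Bs| + size Bs <= \sum_(B <- Bs) #|` B| + 1)%N ->
  (#|` fsetsum X Y| + 1 <= #|` X| + #|` Y|)%N /\
  (#|` fsetsum X Y| + #|` sumset R| <= #|` sumset Bs| + 1)%N.
Proof.
move=> Bs0 pBs; rewrite (perm_sumset pBs) (perm_size pBs) (perm_big _ pBs) /=.
move: Bs0; rewrite (perm_all _ pBs) /= => /and3P[X0 Y0 R0].
rewrite !sumset_cons fsetsumA !big_cons => ltS tight.
have XY0 := card_fsetsum_gt0 X0 Y0.
have Sum0 := card_sumset_gt0 R0.
have cd := Cauchy_Davenport XY0 Sum0 ltS.
have := Cauchy_Davenport_seq R0 (lt_pGW (card_fsetsumr _ XY0) ltS).
by split; cardlia.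
Qed.

Lemma sub_nonempty Bs : all nontrivial Bs -> all nonempty Bs.
Proof. by apply: sub_all => B; apply: ltnW. Qed.

Lemma tight_propagate d Bs B : d != 0 -> all nontrivial Bs ->
    lt_pG G #|` sumset Bs| ->
    (#|` sumset Bs| + size Bs <= \sum_(B <- Bs) #|` B| + 1)%N ->
    B \in Bs -> arc d B ->
  forall C, C \in Bs -> arc d C.
Proof.
move=> d0 Bs2 ltS tight BBs aB C CBs.
have pB := perm_to_rem BBs.
move: CBs; rewrite (perm_mem pB) inE => /orP[/eqP->//|CR].
have pBC : perm_eq Bs (B :: C :: rem C (rem B Bs)).
  by apply: perm_trans pB _; rewrite perm_cons perm_to_rem.
have Bs0 := sub_nonempty Bs2.
have [tBC leBC] := tight_pair Bs0 pBC ltS tight.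
move: Bs2 Bs0; rewrite !(perm_all _ pBC) /= => /and3P[B2 _ _] /and3P[B0 C0 R0].
apply: (arc_propagate d0 aB) => //.
by apply: lt_pGW ltS; have := card_sumset_gt0 R0; cardlia.
Qed.

(** Vosper's theorem needs one unit of room below p(G). A third set of size at least two provides
    it, so the stronger hypothesis is asked only for two sets. *)
Lemma tight_arcs Bs : (2 <= size Bs)%N -> all nontrivial Bs ->
    lt_pG G #|` sumset Bs| ->
    (size Bs = 2%N -> lt_pG G #|` sumset Bs|.+1) ->
    (#|` sumset Bs| + size Bs <= \sum_(B <- Bs) #|` B| + 1)%N ->
  exists2 d, d != 0 & forall B, B \in Bs -> arc d B.
Proof.
move=> Bs_ge2 Bs2 ltS ltS2 tight; have Bs0 := sub_nonempty Bs2.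
have [X [Y [R BsE]]] : exists X Y R, Bs = X :: Y :: R.
  by case: Bs Bs_ge2 {Bs2 ltS ltS2 tight Bs0} => [|X [|Y R]] // _; exists X, Y, R.
have pBs : perm_eq Bs (X :: Y :: R) by rewrite BsE.
have [tXY leXY] := tight_pair Bs0 pBs ltS tight.
have [X2 Y2 R2] : [/\ (1 < #|` X|)%N, (1 < #|` Y|)%N & all nontrivial R].
  by move: Bs2; rewrite BsE /= => /and3P.
have ltXY : lt_pG G #|` fsetsum X Y|.+1.
  case: R BsE R2 leXY {pBs} => [|Z R] BsE /=.
    have -> : sumset [::] = [fset 0] by rewrite /sumset big_nil.
    rewrite cardfs1 leq_add2r => _ le; apply: lt_pGW (ltS2 _) => //.
    by rewrite BsE.
  move=> /andP[Z2 R2]; rewrite sumset_cons => le; apply: lt_pGW ltS.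
  have := card_fsetsumr Z (card_sumset_gt0 (sub_nonempty R2)).
  by rewrite fsetsumC; cardlia.
have [d [d0 aX aY]] := Vosper X2 Y2 ltXY tXY.
exists d => //; apply: (tight_propagate d0 Bs2 ltS tight _ aX).
by rewrite BsE inE eqxx.
Qed.

End Progressions.

(** * Set partitions of a sequence of sets *)

Section BigSum.
Local Open Scope ring_scope.

Lemma bigsumP (G : zmodType) (I : finType) (P : pred I) (F : I -> {fset G}) (x : G) :
  reflect (exists f : I -> G, (forall i : I, P i -> f i \in F i) /\ x = \sum_(i | P i) f i)
    (x \in bigsum P F).
Proof.
apply: (iffP idP) => [|[f [fF ->]]]; last first.
  rewrite /bigsum; elim/big_rec2: _ => [|i X y Pi yX]; first by rewrite inE.
  by apply: mem_fsetsum => //; apply: fF.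
rewrite /bigsum => xS.
suff [f [fF xE]] : exists f : I -> G,
    (forall i : I, i \in index_enum I -> P i -> f i \in F i) /\ x = \sum_(i | P i) f i.
  by exists f; split=> // i; apply: fF; rewrite mem_index_enum.
elim: index_enum (index_enum_uniq I) x xS => [_ x|i r IHr /= /andP[ir ur] x].
  by rewrite big_nil inE => /eqP->; exists (fun=> 0); rewrite big_nil.
rewrite !big_cons; case: (boolP (P i)) => Pi.
  move=> /in_fsetsum[y [z [yF /(IHr ur)[f [fF ->]] ->]]].
  exists (fun j => if j == i then y else f j); split=> [j|].
    by rewrite inE; case: eqVneq => [->|_] //=; apply: fF.
  rewrite big_cons Pi eqxx; congr (_ + _).
  rewrite big_seq_cond [RHS]big_seq_cond; apply: eq_bigr => j /andP[jr _].
  by case: eqVneq jr ir => // -> ->.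
move=> /(IHr ur)[f [fF ->]]; exists f; split; last by rewrite big_cons (negPf Pi).
by move=> j; rewrite inE => /orP[/eqP->|/fF//]; rewrite (negPf Pi).
Qed.

End BigSum.

Section Systems.
Local Open Scope ring_scope.
Variables (G : zmodType) (m : nat).
Implicit Types (A : 'I_m -> {fset G}) (Bs : seq {fset G}) (J K : {set 'I_m}).
Implicit Types (l : nat) (i j k : 'I_m) (a b x : G).

Lemma in_Aunion A a : reflect (exists i, a \in A i) (a \in Aunion A).
Proof.
apply: (iffP (bigfcupP _ _ _ _)) => [[i _ ai]|[i ai]]; exists i => //.
by rewrite mem_index_enum.
Qed.

Lemma Aunion_sup A i : A i `<=` Aunion A.
Proof. by apply/fsubsetP => a ai; apply/in_Aunion; exists i. Qed.

Definition mult A J a : nat := (\sum_(j in J) (a \in A j))%N.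

Lemma multE A J a : mult A J a = #|[set j in J | a \in A j]|.
Proof.
rewrite /mult -sum1_card big_mkcond [RHS]big_mkcond /=; apply: eq_bigr => j _.
by rewrite inE; case: (j \in J); case: (a \in A j).
Qed.

Lemma multD1 A J i a : i \in J -> mult A J a = ((a \in A i) + mult A (J :\ i) a)%N.
Proof. exact: big_setD1. Qed.

Lemma mult_gt0 A a : (0 < mult A setT a)%N = (a \in Aunion A).
Proof.
rewrite multE card_gt0; apply/set0Pn/in_Aunion => -[j]; first by rewrite !inE; exists j.
by move=> aj; exists j; rewrite !inE.
Qed.

Lemma mult_le A J a : (mult A J a <= mult A setT a)%N.
Proof. by rewrite !multE subset_leq_card //; apply/subsetP => j; rewrite !inE => /andP[]. Qed.

Lemma muE l A a : mu l A a = minn l (mult A setT a).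
Proof. by rewrite multE /mu; congr minn; apply: eq_card => j; rewrite !inE. Qed.

(** The analogue of [M] on the index set [J]: its elements still have a free index in [J] after any
    [l - 1] indices are used. *)
Definition saturated l A J : {fset G} := [fset a in Aunion A | (l <= mult A J a)%N].

Lemma in_saturated l A J a : (0 < l)%N -> (a \in saturated l A J) = (l <= mult A J a)%N.
Proof.
move=> l0; rewrite !inE /= andb_idl // -mult_gt0 => /(leq_trans l0) /leq_trans.
by apply; apply: mult_le.
Qed.

Lemma Mset_saturated l A : Mset l A = saturated l A setT.
Proof.
apply/fsetP => a; rewrite !inE /= muE; congr (_ && _).
by apply/eqP/idP; lia.
Qed.

Definition in_Sigma l A J x : Prop :=
  exists (K : {set 'I_m}) (f : 'I_m -> G),
    [/\ K \subset J, #|K| = l, forall k, k \in K -> f k \in A k & x = \sum_(k in K) f k].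

Lemma SigmaP l A x : reflect (in_Sigma l A setT x) (x \in Sigma l A).
Proof.
apply: (iffP (bigfcupP _ _ _ _)).
  move=> [K /andP[_ /eqP cK] /bigsumP[f [fA ->]]].
  by exists K, f; rewrite subsetT.
move=> [K [f [_ cK fA ->]]]; exists K; first by rewrite mem_index_enum cK eqxx.
by apply/bigsumP; exists f.
Qed.

Local Notation nontrivial := (fun B : {fset G} => 1 < #|` B|)%N.

(** A set partition into [l] sets of the multiset where [a] is repeated [minn l (mult A J a)] times,
    with sumset controlled by the sets indexed by [J]. *)
Definition setpart l A J Bs : Prop :=
  [/\ size Bs = l, all nontrivial Bs,
      forall a, (\sum_(B <- Bs) (a \in B))%N = minn l (mult A J a)
    & forall x, x \in sumset Bs -> in_Sigma l A J x].

Lemma setpart_cons l A J i Bs : i \in J -> (1 < #|` A i|)%N ->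
    setpart l A (J :\ i) Bs ->
  setpart l.+1 A J ((A i `|` saturated l.+1 A J) :: Bs).
Proof.
move=> iJ Ai2 [sBs Bs2 multBs sumBs]; split=> /=; first by rewrite sBs.
- rewrite Bs2 andbT; apply: leq_trans Ai2 _.
  by rewrite fsubset_leq_card // fsubsetUl.
- move=> a; rewrite big_cons multBs in_fsetU in_saturated // (multD1 A a iJ).
  by case: (a \in A i) => /=; lia.
move=> x; rewrite sumset_cons => /in_fsetsum[b [y [bB /sumBs[K [f [sKJ cK fA ->]]] ->]]].
have iK : i \notin K by apply/negP => /(subsetP sKJ); rewrite !inE eqxx.
have [j [jJ jK bAj]] : exists j, [/\ j \in J, j \notin K & b \in A j].
  move: bB; rewrite in_fsetU in_saturated // => /orP[bAi|]; first by exists i.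
  rewrite multE -cK => leKL.
  have /subsetPn[j] : ~~ ([set j in J | b \in A j] \subset K).
    by apply/negP => /subset_leq_card; rewrite leqNgt leKL.
  by rewrite inE => /andP[jJ bAj] jK; exists j.
exists (j |: K), (fun k => if k == j then b else f k); split.
- by rewrite subUset sub1set jJ (subset_trans sKJ) // subD1set.
- by rewrite cardsU1 jK cK.
- by move=> k; rewrite !inE; case: eqVneq => [->|_] //=; apply: fA.
rewrite big_setU1 //= eqxx; congr (_ + _); apply: eq_bigr => k kK.
by case: eqVneq kK jK => // -> ->.
Qed.

(** Only [l] sets need two elements, which leaves room for a small intersection after uncrossing. *)
Lemma setpart_exists l A J : (l <= #|[set j in J | (1 < #|` A j|)%N]|)%N ->
  exists Bs, setpart l A J Bs.
Proof.
elim: l J => [|l IHl] J.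
  move=> _; exists [::]; split=> //= [a|x]; first by rewrite big_nil min0n.
  rewrite /sumset big_nil inE => /eqP->; exists set0, (fun=> 0).
  by rewrite sub0set cards0 big_set0; split=> // k; rewrite inE.
move=> lt_l; have /card_gt0P[i] := leq_ltn_trans (leq0n l) lt_l.
rewrite inE => /andP[iJ Ai2].
have [|Bs pBs] := IHl (J :\ i); last first.
  exists ((A i `|` saturated l.+1 A J) :: Bs); exact: setpart_cons.
rewrite -ltnS; apply: leq_trans lt_l _; rewrite [leqLHS](cardsD1 i) inE iJ Ai2 ltnS.
by apply: subset_leq_card; apply/subsetP => j; rewrite !inE => /and3P[-> -> ->].
Qed.

(** Double counting of the pairs formed by a member of [Bs] and one of its elements. *)
Lemma card_setpart l A Bs : setpart l A setT Bs ->
  (\sum_(B <- Bs) #|` B| = \sum_(a <- Aunion A) mu l A a)%N.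
Proof.
move=> [_ _ multBs _].
under [RHS]eq_bigr => a _ do rewrite muE -multBs.
rewrite exchange_big /=; apply: eq_big_seq => B BBs.
have sB : B `<=` Aunion A.
  apply/fsubsetP => a aB; rewrite -mult_gt0.
  have := multBs a; rewrite (big_rem B) //= aB; lia.
have -> : (\sum_(a <- Aunion A) (a \in B))%N = count (mem B) (Aunion A).
  by rewrite -sum1_count [RHS]big_mkcond; apply: eq_bigr => a _; reflexivity.
rewrite -size_filter; apply/esym/perm_size/uniq_perm => // [|a].
  by rewrite filter_uniq.
by rewrite mem_filter andb_idr //; apply: (fsubsetP sB).
Qed.

End Systems.

(** * The case of equality *)

Section ThreeArcs.
Local Open Scope ring_scope.
Variables (G : zmodType) (d : G).
Implicit Types X Y Z : {fset G}.
Hypothesis d0 : d != 0.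

(** As [x] already starts the unions of [X] with [Y] and with [Z], every starting point of [Y] or
    [Z] must be preceded by an element of [X]. Two such points then both start the union of [Y] and
    [Z], so they coincide, against disjointness. *)
Lemma no_three_arcs_start X Y Z : [disjoint X & Y] -> [disjoint X & Z] ->
    [disjoint Y & Z] -> (0 < #|` Y|)%N -> (0 < #|` Z|)%N ->
    arc d (X `|` Y) -> arc d (X `|` Z) -> arc d (Y `|` Z) ->
    lt_pG G #|` Y| -> lt_pG G #|` Z| ->
  forall x, x \in X -> x - d \notin X -> x - d \notin Y -> x - d \notin Z -> False.
Proof.
move=> dXY dXZ dYZ Y0 Z0 aXY aXZ aYZ ltY ltZ x xX xdX xdY xdZ.
have covered W : [disjoint X & W] -> arc d (X `|` W) -> x - d \notin W ->
    forall y, y \in W -> y - d \notin W -> y - d \in X.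
  move=> dXW aXW xdW y yW ydW; apply: contraT => ydX.
  have yx : y = x.
    by apply: aXW; rewrite inE ?yW ?xX ?orbT // negb_or ?ydX ?ydW ?xdX ?xdW.
  by move/fdisjointP: dXW => /(_ x xX); rewrite -yx yW.
have [y yY ydY] := start_exists ltY Y0 d0.
have [w wZ wdZ] := start_exists ltZ Z0 d0.
have ydX := covered Y dXY aXY xdY y yY ydY.
have wdX := covered Z dXZ aXZ xdZ w wZ wdZ.
have ydZ : y - d \notin Z by move/fdisjointP: dXZ; apply.
have wdY : w - d \notin Y by move/fdisjointP: dXY; apply.
have yw : y = w.
  by apply: aYZ; rewrite inE ?yY ?wZ ?orbT // negb_or ?ydY ?ydZ ?wdY ?wdZ.
by move/fdisjointP: dYZ => /(_ y yY); rewrite yw wZ.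
Qed.

Lemma no_three_arcs X Y Z : [disjoint X & Y] -> [disjoint X & Z] ->
    [disjoint Y & Z] -> (0 < #|` X|)%N -> (0 < #|` Y|)%N -> (0 < #|` Z|)%N ->
    arc d (X `|` Y) -> arc d (X `|` Z) -> arc d (Y `|` Z) ->
  ~ lt_pG G #|` X `|` Y `|` Z|.
Proof.
move=> dXY dXZ dYZ X0 Y0 Z0 aXY aXZ aYZ ltV.
have ltW W : W `<=` X `|` Y `|` Z -> lt_pG G #|` W|.
  by move=> sW; apply: lt_pGW ltV; apply: fsubset_leq_card.
have ltX : lt_pG G #|` X| by apply: ltW; rewrite -fsetUA fsubsetUl.
have ltY : lt_pG G #|` Y| by apply: ltW; rewrite fsetUAC fsubsetUr.
have ltZ : lt_pG G #|` Z| by apply: ltW; rewrite fsubsetUr.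
have V0 : (0 < #|` X `|` Y `|` Z|)%N.
  by apply: leq_trans Z0 _; apply: fsubset_leq_card; rewrite fsubsetUr.
have [x + ] := start_exists ltV V0 d0; rewrite !inE !negb_or.
have [dYX dZX dZY] : [/\ [disjoint Y & X], [disjoint Z & X] & [disjoint Z & Y]].
  by rewrite ![[disjoint _ & X]]fdisjoint_sym [[disjoint Z & _]]fdisjoint_sym.
move=> /orP[/orP[xX|xY]|xZ] /andP[/andP[xdX xdY] xdZ].
- exact: (@no_three_arcs_start X Y Z) xX xdX xdY xdZ.
- by apply: (@no_three_arcs_start Y X Z) xY xdY xdX xdZ => //; rewrite fsetUC.
- by apply: (@no_three_arcs_start Z X Y) xZ xdZ xdX xdY => //; rewrite fsetUC.
Qed.

End ThreeArcs.

Section OrdinalCardinals.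
Variable m : nat.
Implicit Types i j k : 'I_m.

Lemma card_ord_setD1 i : #|[set: 'I_m] :\ i| = m.-1.
Proof.
by have /(congr1 predn) := cardsD1 i setT; rewrite in_setT cardsT card_ord add1n => /= <-.
Qed.

Lemma card_ord_setD2 i j : i != j -> #|[set: 'I_m] :\ i :\ j| = m.-2.
Proof.
move=> ij; have /(congr1 predn) := cardsD1 j (setT :\ i).
by rewrite !inE eq_sym ij card_ord_setD1 add1n => /= <-.
Qed.

Lemma card_ord_setD3 i j k : i != j -> i != k -> j != k ->
  #|[set: 'I_m] :\ i :\ j :\ k| = m.-2.-1.
Proof.
move=> ij ik jk; have /(congr1 predn) := cardsD1 k (setT :\ i :\ j).
by rewrite !inE ![k == _]eq_sym ik jk card_ord_setD2 // add1n => /= <-.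
Qed.

End OrdinalCardinals.

(** * Structure of the sets [A i] under equality *)

Section Equality.
Local Open Scope ring_scope.
Variables (G : zmodType) (m l : nat) (A : 'I_m -> {fset G}).
Implicit Types (D : 'I_m -> {fset G}) (Bs : seq {fset G}) (J : {set 'I_m}).
Implicit Types (i j k : 'I_m) (a d x : G).

Local Notation M := (Mset l A).
Local Notation nontrivial := (fun B : {fset G} => 1 < #|` B|)%N.

(** The conditions under which a set partition of [D] can serve as one of [A]. *)
Definition dominated D : Prop :=
  (forall a, mult D setT a = mult A setT a) /\
  (forall x, in_Sigma l D setT x -> in_Sigma l A setT x).

Definition uncross i j k : {fset G} :=
  if k == i then A i `|` A j else if k == j then A i `&` A j else A k.

(** If the summand chosen at [i] is not in [A i], it lies in [A j], while a summand chosen at [j]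
    lies in both sets; exchanging the two indices repairs the choice. Otherwise the choice is
    already valid for [A]. *)
Lemma dominated_uncross i j : i != j -> dominated (uncross i j).
Proof.
move=> ij; have uj : uncross i j j = A i `&` A j.
  by rewrite /uncross eq_sym (negPf ij) eqxx.
have ui : uncross i j i = A i `|` A j by rewrite /uncross eqxx.
have uk k : k != i -> k != j -> uncross i j k = A k.
  by rewrite /uncross => /negPf -> /negPf ->.
split=> [a|x [K [f [_ cK fD ->]]]].
  have iT : i \in setT by rewrite inE.
  have jT : j \in setT :\ i by rewrite !inE eq_sym ij.
  rewrite !(multD1 _ _ iT) !(multD1 _ _ jT) ui uj !inE !addnA; congr (_ + _)%N.
    by case: (a \in A i); case: (a \in A j).
  by apply: eq_bigr => k; rewrite !inE => /and3P[kj ki _]; rewrite uk.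
have [/andP[iK fiA]|Hi] := boolP ((i \in K) && (f i \notin A i)).
  exists (tperm i j @: K), (f \o tperm i j); rewrite subsetT.
  split=> //; first by rewrite card_imset //; apply: perm_inj.
    move=> _ /imsetP[u uK ->]; rewrite /= tpermK; have := fD u uK.
    case: tpermP => [ui'|uj'|ui' uj']; rewrite ?ui' ?uj' ?ui ?uj.
    - by rewrite inE (negPf fiA).
    - by rewrite inE => /andP[].
    - by rewrite uk //; apply/eqP.
  rewrite big_imset /=; last by move=> u v _ _; apply: perm_inj.
  by apply: eq_bigr => u _; rewrite tpermK.
exists K, f; rewrite subsetT; split=> // k kK; have := fD k kK.
have [ki|ki] := eqVneq k i.
  by move=> _; move: Hi; rewrite -ki kK negbK.
have [->|kj] := eqVneq k j; first by rewrite uj inE => /andP[].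
by rewrite uk.
Qed.

Lemma dominated_refl : dominated A. Proof. by []. Qed.

Hypotheses (l_gt0 : (0 < l)%N).

Lemma saturated_dominated D : dominated D -> saturated l D setT = M.
Proof.
move=> [multD _]; rewrite Mset_saturated; apply/fsetP => a.
by rewrite !in_saturated // multD.
Qed.

Lemma setpart_bound D Bs : dominated D -> setpart l D setT Bs ->
  sumset Bs `<=` Sigma l A /\
  (\sum_(B <- Bs) #|` B| = \sum_(a <- Aunion A) mu l A a)%N.
Proof.
move=> [multD sumD] pBs; split.
  by apply/fsubsetP => x; case: pBs => _ _ _ sB /sB /sumD /SigmaP.
rewrite (card_setpart pBs).
have -> : Aunion D = Aunion A by apply/fsetP => a; rewrite -!mult_gt0 multD.
by apply: eq_bigr => a _; rewrite !muE multD.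
Qed.

Lemma setpart_head D i : dominated D -> (1 < #|` D i|)%N ->
    (l.-1 <= #|[set j in setT :\ i | (1 < #|` D j|)%N]|)%N ->
  exists Bs, setpart l D setT ((D i `|` M) :: Bs).
Proof.
move=> dD Di2 /setpart_exists[Bs pBs]; exists Bs.
rewrite -(saturated_dominated dD) -(prednK l_gt0).
by apply: setpart_cons => //; rewrite inE.
Qed.

Hypotheses (hl : (2 <= l)%N) (hlm : (l < m)%N).
Hypothesis hA : forall i, (2 <= #|` A i|)%N.
Lemma card_nontrivial J : #|[set j in J | (1 < #|` A j|)%N]| = #|J|.
Proof. by apply: eq_card => j; rewrite inE hA andbT. Qed.

Lemma setpart_headA i : exists Bs, setpart l A setT ((A i `|` M) :: Bs).
Proof.
apply: setpart_head => //.
by rewrite card_nontrivial card_ord_setD1; lia.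
Qed.

Hypothesis ltS : lt_pG G #|` Sigma l A|.
Hypothesis ltS2 : l = 2%N -> lt_pG G #|` Sigma l A|.+1.
Hypothesis tight :
  (#|` Sigma l A| + l = (\sum_(a <- Aunion A) mu l A a) + 1)%N.

(** The sumset lies in [Sigma l A], and by Cauchy-Davenport it is at least as large as equality
    allows for [Sigma l A]; so the two coincide. *)
Lemma setpart_tight D Bs : dominated D -> setpart l D setT Bs ->
  sumset Bs = Sigma l A /\
  (#|` sumset Bs| + size Bs <= \sum_(B <- Bs) #|` B| + 1)%N.
Proof.
move=> dD pBs; have [sBs cBs] := setpart_bound dD pBs.
have [sz Bs2 _ _] := pBs.
have ltBs := lt_pGW (fsubset_leq_card sBs) ltS.
have cd := Cauchy_Davenport_seq (sub_nonempty Bs2) ltBs.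
have SE : sumset Bs = Sigma l A.
  apply/eqP; rewrite eqEfcard sBs /=.
  by move: cd; rewrite cBs -tight sz leq_add2r.
by split=> //; rewrite SE cBs sz tight.
Qed.

Lemma setpart_arcs D Bs : dominated D -> setpart l D setT Bs ->
  exists2 d, d != 0 & forall B, B \in Bs -> arc d B.
Proof.
move=> dD pBs; have [SE tBs] := setpart_tight dD pBs.
have [sz Bs2 _ _] := pBs.
by rewrite SE sz in tBs; apply: tight_arcs; rewrite ?SE ?sz.
Qed.

Lemma setpart_propagate D Bs d B C : dominated D -> setpart l D setT Bs ->
  d != 0 -> B \in Bs -> arc d B -> C \in Bs -> arc d C.
Proof.
move=> dD pBs d0 BBs aB; have [SE tBs] := setpart_tight dD pBs.
have [_ Bs2 _ _] := pBs.
by apply: (tight_propagate d0 Bs2 _ tBs BBs aB); rewrite SE.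
Qed.

Lemma card_setpart_mem D Bs B : dominated D -> setpart l D setT Bs -> B \in Bs ->
  (#|` B| <= #|` Sigma l A|)%N.
Proof.
move=> dD pBs BBs; have [<- _] := setpart_tight dD pBs.
have [_ Bs2 _ _] := pBs; have pB := perm_to_rem BBs.
rewrite (perm_sumset pB) sumset_cons fsetsumC card_fsetsumr // card_sumset_gt0 //.
by move: (sub_nonempty Bs2); rewrite (perm_all _ pB) => /andP[].
Qed.

(* The two set partitions starting with [D i] and [D k] in either order share
   all their other members, so their common differences agree. *)
Lemma arc_link D i k d : (3 <= l)%N -> dominated D -> i != k ->
    (1 < #|` D i|)%N -> (1 < #|` D k|)%N ->
    (l.-2 <= #|[set j in setT :\ i :\ k | (1 < #|` D j|)%N]|)%N ->
    d != 0 -> arc d (D i `|` M) -> arc d (D k `|` M).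
Proof.
move=> l3 dD ik Di2 Dk2 /setpart_exists[R pR] d0 aDi.
have lE : l = l.-2.+2 by lia.
have [iT kT] : i \in setT /\ k \in setT by rewrite !inE.
have [iTk kTi] : i \in setT :\ k /\ k \in setT :\ i by rewrite !inE ik eq_sym ik.
have pR' : setpart l.-2 D (setT :\ k :\ i) R.
  by have <- : setT :\ i :\ k = setT :\ k :\ i by apply/setP => j; rewrite !inE andbCA.
have p1 := setpart_cons iT Di2 (setpart_cons kTi Dk2 pR).
have p2 := setpart_cons kT Dk2 (setpart_cons iTk Di2 pR').
rewrite -lE saturated_dominated // in p1; rewrite -lE saturated_dominated // in p2.
case: R {pR pR'} p1 p2 => [[sz _ _ _]|B R p1 p2]; first by move: sz => /=; lia.
have aB : arc d B.
  by apply: (setpart_propagate dD p1 d0 _ aDi); rewrite !inE eqxx ?orbT.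
by apply: (setpart_propagate dD p2 d0 _ aB); rewrite !inE eqxx ?orbT.
Qed.

Lemma common_difference : (3 <= l)%N -> exists d, [/\ d != 0,
  forall i, arc d (A i `|` M) & forall i j, i != j -> arc d (A i `|` A j `|` M)].
Proof.
move=> l3; have m0 : (0 < m)%N by lia.
pose i0 := Ordinal m0.
have [Bs pBs] := setpart_headA i0.
have [d d0 aBs] := setpart_arcs dominated_refl pBs.
have aA i : arc d (A i `|` M).
  have ai0 : arc d (A i0 `|` M) by apply: aBs; rewrite inE eqxx.
  have [<-//|ii0] := eqVneq i0 i.
  apply: (arc_link l3 dominated_refl ii0) => //; rewrite card_nontrivial.
  by rewrite card_ord_setD2 //; lia.
exists d; split=> // i j ij.
have [k] : exists k, k \in setT :\ i :\ j.
  by apply/card_gt0P; rewrite card_ord_setD2 //; lia.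
rewrite !inE => /and3P[kj ki _].
(* Uncrossing [i] and [j] leaves [A k] untouched, so the difference known for [A k] is linked to the
   union of [A i] and [A j]. *)
have dU := dominated_uncross ij.
have uk : uncross i j k = A k by rewrite /uncross (negPf ki) (negPf kj).
have ui : uncross i j i = A i `|` A j by rewrite /uncross eqxx.
rewrite -ui; apply: (arc_link l3 dU ki) => //; rewrite ?uk ?ui //.
  by apply: leq_trans (hA i) (fsubset_leq_card _); apply: fsubsetUl.
(* The intersection placed at [j] may be small, so it is not counted; the other [m - 3] sets
   suffice. *)
apply: leq_trans (_ : #|setT :\ k :\ i :\ j| <= _)%N.
  by rewrite card_ord_setD3 //; lia.
apply: subset_leq_card; apply/subsetP => u; rewrite !inE => /and4P[uj ui' uk' _].
by rewrite ui' uk' /uncross (negPf ui') (negPf uj) hA.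
Qed.

Lemma card_bigfcup_leq J (F : 'I_m -> {fset G}) :
  (#|` \bigcup_(j in J) F j| <= \sum_(j in J) #|` F j|)%N.
Proof.
elim/big_rec2: _ => [|j n X _ leX]; first by rewrite cardfs0.
by rewrite cardfsU (leq_trans (leq_subr _ _)) // leq_add2l.
Qed.

(** Serves to place the whole union below p(G). One element of [M] already accounts for the excess
    [l - 1]; if [M] is empty, the excess comes from overlaps among the sets [A i]. *)
Lemma card_Aunion : (3 <= l)%N ->
  (#|` Aunion A| + l <= \sum_(a <- Aunion A) mu l A a + 1)%N.
Proof.
move=> l3; have [M0|/fset0Pn[a aM]] := eqVneq M fset0; last first.
  move: aM; rewrite !inE /= => /andP[aA /eqP mua].
  rewrite (big_rem a) //= mua.
  have : (size (rem a (Aunion A)) <= \sum_(b <- rem a (Aunion A)) mu l A b)%N.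
    rewrite -sum1_size !big_seq; apply: leq_sum => b /mem_rem.
    by rewrite -mult_gt0 muE; lia.
  rewrite size_rem // => leA; rewrite addnC -addnA leq_add2l addn1.
  by apply: leq_trans (leqSpred _) _.
have NE : (\sum_(a <- Aunion A) mu l A a = \sum_i #|` A i|)%N.
  have -> : (\sum_(a <- Aunion A) mu l A a = \sum_(a <- Aunion A) mult A setT a)%N.
    apply: eq_bigr => a _; rewrite muE; apply/minn_idPr/ltnW; rewrite ltnNge.
    by rewrite -in_saturated // -Mset_saturated M0 inE.
  rewrite exchange_big /=; apply: eq_big => [i|i _]; first by rewrite inE.
  have -> : (\sum_(a <- Aunion A) (a \in A i))%N = count (mem (A i)) (Aunion A).
    by rewrite -sum1_count [RHS]big_mkcond; apply: eq_bigr => a _; reflexivity.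
  rewrite -size_filter; apply/perm_size/uniq_perm => // [|a].
    by rewrite filter_uniq.
  by rewrite mem_filter andb_idr //; apply: (fsubsetP (Aunion_sup A i)).
have [d [d0 _ aU]] := common_difference l3.
have {}aU i j : i != j -> arc d (A i `|` A j).
  by move=> /aU; rewrite M0 fsetU0.
have A0 i : (0 < #|` A i|)%N by rewrite ltnW.
have sum2 i j : i != j -> (\sum_u #|` A u| =
    #|` A i| + (#|` A j| + \sum_(u in setT :\ i :\ j) #|` A u|))%N.
  move=> ij; rewrite (bigD1 i) //= (bigD1 j) 1?eq_sym //=; do 2 congr (_ + _)%N.
  by apply: eq_bigl => u; rewrite !inE andbT andbC.
(* The other [m - 3] sets have at least two elements each, so equality bounds the union of these
   three by [#|Sigma l A| + 3 - l], hence below p(G) as [l] is at least 3. *)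
have no3 i j k : i != j -> i != k -> j != k -> [disjoint A i & A j] ->
    [disjoint A i & A k] -> [disjoint A j & A k] -> False.
  move=> ij ik jk dij dik djk.
  apply: (@no_three_arcs _ d d0 (A i) (A j) (A k)) => //; [exact: aU..|].
  apply: lt_pGW ltS.
  have := sum2 i j ij; rewrite (big_setD1 k) /=; last by rewrite !inE ![k == _]eq_sym ik jk.
  have : (#|setT :\ i :\ j :\ k| * 2 <= \sum_(u in setT :\ i :\ j :\ k) #|` A u|)%N.
    by rewrite -sum_nat_const; apply: leq_sum.
  rewrite card_ord_setD3 //.
  have := cardfsU (A i `|` A j) (A k); have := cardfsU (A i) (A j).
  have := tight; rewrite NE.
  set N := (\sum_u _)%N; set R := (\sum_(u in _) _)%N.
  cardlia.
(* Take a disjoint pair if there is one, so that [no3] applies; otherwise any pair works. *)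
have [i [j [ij meets]]] : exists i j, i != j /\
    forall k, k != i -> k != j -> ~~ fdisjoint (A k) (A i `|` A j).
  have [/existsP[i /existsP[j /andP[ij dij]]]|/existsPn nodisj] :=
    boolP [exists i, exists j, (i != j) && fdisjoint (A i) (A j)].
    exists i, j; split=> // k ki kj; apply/negP; rewrite fdisjointXU => /andP[dki dkj].
    by apply: (no3 k i j).
  have m0 : (0 < m)%N by lia.
  have m1 : (1 < m)%N by lia.
  exists (Ordinal m0), (Ordinal m1); split=> // k k0 _.
  rewrite fdisjointXU negb_and; apply/orP; left.
  by have /existsPn/(_ (Ordinal m0)) := nodisj k; rewrite k0.
pose W := A i `|` A j; pose J := setT :\ i :\ j.
pose U := \bigcup_(k in J) (A k `\` W).
have sU : Aunion A `<=` W `|` U.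
  apply/fsubsetP => a /in_Aunion[k ak]; rewrite in_fsetU.
  have [//|aW] := boolP (a \in W); apply/bigfcupP; exists k; last first.
    by rewrite inE aW.
  rewrite mem_index_enum /J !inE andbT /=.
  by rewrite /W in aW; apply/andP; split; apply: contraNneq aW => <-; rewrite inE ak ?orbT.
(* Each of the [m - 2] remaining sets loses an element to [W], and [m - 2] is at least [l - 1]. *)
have leJ : (\sum_(k in J) #|` A k `\` W| + #|J| <= \sum_(k in J) #|` A k|)%N.
  rewrite -sum1_card -big_split /=; apply: leq_sum => k; rewrite /J !inE andbT => /andP[kj ki].
  have : (0 < #|` A k `&` W|)%N.
    by have := meets k ki kj; rewrite -fsetI_eq0 cardfs_gt0.
  by have := cardfsID W (A k); cardlia.
have leU : (#|` U| <= \sum_(k in J) #|` A k `\` W|)%N by apply: card_bigfcup_leq.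
move: leU; have := fsubset_leq_card sU; have := cardfsU W U; have := cardfsU (A i) (A j).
have := sum2 i j ij; have := card_ord_setD2 ij; rewrite NE -/W -/J.
move: leJ; set N := (\sum_u _)%N; set R := (\sum_(k in J) #|` A k|)%N.
set Q := (\sum_(k in J) _)%N; set c := #|J|.
cardlia.
Qed.

(** The difference may depend on [i]: for [l = 2], partitions headed by different indices need not
    share a member. *)
Lemma is_AP_AiM2 : l = 2%N -> forall i, exists d, is_AP (A i `|` M) d.
Proof.
move=> l2 i; have [Bs pBs] := setpart_headA i.
have [d d0 aBs] := setpart_arcs dominated_refl pBs.
exists d; have iB : A i `|` M \in (A i `|` M) :: Bs by rewrite inE eqxx.
apply: arc_is_AP => //; first exact: aBs.
  by case: pBs => _ /= /andP[/ltnW].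
exact: lt_pGW (card_setpart_mem dominated_refl pBs iB) ltS.
Qed.

Lemma is_AP_AiM : (3 <= l)%N -> exists d,
  is_AP (Aunion A) d /\ forall i, is_AP (A i `|` M) d.
Proof.
move=> l3; have [d [d0 aA aU]] := common_difference l3; exists d.
have m0 : (0 < m)%N by lia.
split=> [|i]; last first.
  have [Bs pBs] := setpart_headA i.
  have iB : A i `|` M \in (A i `|` M) :: Bs by rewrite inE eqxx.
  apply: arc_is_AP => //; first by case: pBs => _ /= /andP[/ltnW].
  exact: lt_pGW (card_setpart_mem dominated_refl pBs iB) ltS.
apply: arc_is_AP => //.
- have sM : M `<=` Aunion A by apply: fset_sub.
  move=> x y /in_Aunion[i xi] /in_Aunion[j yj] xd yd.
  have sU : A i `|` A j `|` M `<=` Aunion A by rewrite !fsubUset !Aunion_sup.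
  have aij : arc d (A i `|` A j `|` M).
    by have [->|/aU//] := eqVneq i j; rewrite fsetUid.
  have notin z : z \notin Aunion A -> z \notin A i `|` A j `|` M.
    by apply: contra; apply: (fsubsetP sU).
  by apply: aij (notin _ xd) (notin _ yd); rewrite !in_fsetU ?xi ?yj ?orbT.
- apply: leq_trans (ltnW (hA (Ordinal m0))) (fsubset_leq_card _).
  exact: Aunion_sup.
(* Under equality, [card_Aunion] says that the union is no larger than [Sigma l A]. *)
- by apply: lt_pGW ltS; have := card_Aunion l3; rewrite -tight leq_add2r.
Qed.

End Equality.

(** * Minimizing sequences and equality *)

Section Minimizing.
Local Open Scope ring_scope.
Variables (G : zmodType) (m l : nat) (A : 'I_m -> {fset G}).
Implicit Types (d a : G).

Lemma finite_choice (T : Type) (t0 : T) (P : nat -> T -> Prop) n :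
  (forall i, (i < n)%N -> exists t, P i t) ->
  exists s : nat -> T, forall i, (i < n)%N -> P i (s i).
Proof.
elim: n => [|n IHn] exP; first by exists (fun=> t0).
have [|s sP] := IHn; first by move=> i lt_in; apply: exP; apply: ltnW.
have [t tP] := exP n (ltnSn n).
exists (fun i => if i == n then t else s i) => i; rewrite ltnS leq_eqVlt.
by case: eqVneq => [->|_ /=] //; apply: sP.
Qed.

Lemma big_mkseq (R T : Type) (op : R -> R -> R) idx n (f : nat -> T) (F : T -> R) :
  \big[op/idx]_(x <- mkseq f n) F x = \big[op/idx]_(i < n) F (f i).
Proof. by rewrite big_map -(big_mkord xpredT (fun i => F (f i))) /index_iota subn0. Qed.

Lemma bigsum_sumset (B : nat -> {fset G}) :
  bigsum xpredT (fun j : 'I_l => B j) = sumset (mkseq B l).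
Proof. by rewrite /sumset big_mkseq. Qed.

(** The sets [B i] form a set partition of [A]. Cauchy-Davenport gives one inequality and their
    common difference the other. *)
Lemma minimizing_tight d : (0 < l)%N -> lt_pG G #|` Sigma l A| ->
  minimizing l d A ->
  (#|` Sigma l A| + l = (\sum_(a <- Aunion A) mu l A a) + 1)%N.
Proof.
move=> l0 ltS [B [al [be [BA [d0 [apB _]] muB]]]].
rewrite bigsum_sumset; set Bs := mkseq B l => SE.
have inBs X : X \in Bs -> exists2 i, (i < l)%N & X = B i.
  by move=> /mapP[i]; rewrite mem_iota => il ->; exists i.
have Bs2 : all (fun X : {fset G} => 1 < #|` X|)%N Bs.
  by apply/allP => X /inBs[i /BA[_ ?] ->].
have pBs : setpart l A setT Bs.
  split=> // [|a|x]; first by rewrite size_mkseq.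
    rewrite big_mkseq.
    have [aA|aA] := boolP (a \in Aunion A); first by rewrite -muB // muE.
    have -> : mult A setT a = 0%N.
      by apply/eqP; rewrite -leqn0 leqNgt mult_gt0.
    rewrite minn0 big1 // => j _; apply/eqP; rewrite eqb0.
    by apply: contra aA; apply/fsubsetP; case: (BA j (ltn_ord j)).
  by rewrite SE => /SigmaP.
rewrite -SE in ltS *; rewrite -(card_setpart pBs).
have sz : size Bs = l by rewrite size_mkseq.
apply/eqP; rewrite eqn_leq -sz; apply/andP; split.
  apply: (card_sumset_arcs d0) => //; first exact: sub_nonempty.
  by move=> X /inBs[i il ->]; apply/is_AP_arc/is_AP_typeP/apB.
exact: Cauchy_Davenport_seq (sub_nonempty Bs2) ltS.
Qed.

(** Any set partition of [A] will do: equality makes its sumset all of [Sigma l A] and its members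
    progressions of one difference. *)
Lemma tight_minimizing : (2 <= l)%N -> (l < m)%N ->
    (forall i, (2 <= #|` A i|)%N) -> lt_pG G #|` Sigma l A| ->
    (l = 2%N -> lt_pG G #|` Sigma l A|.+1) ->
    (#|` Sigma l A| + l = (\sum_(a <- Aunion A) mu l A a) + 1)%N ->
  exists d, minimizing l d A.
Proof.
move=> l2 lm hA ltS ltS2 tight.
have m0 : (0 < m)%N by lia.
have l0 : (0 < l)%N by lia.
have [Bs1 pBs] := setpart_headA l0 l2 lm hA (Ordinal m0).
move: (_ :: Bs1) pBs => Bs pBs.
have dA := @dominated_refl G m l A.
have [d d0 aBs] := setpart_arcs l2 ltS ltS2 tight dA pBs.
have [SE _] := setpart_tight ltS tight dA pBs.
have [sz /allP Bs2 multBs _] := pBs.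
pose B i := nth fset0 Bs i.
have inBs i : (i < l)%N -> B i \in Bs by move=> il; rewrite mem_nth ?sz.
have BsE : Bs = mkseq B l by rewrite -sz /B mkseq_nth.
have exs i : (i < l)%N -> exists a, B i = [fset (a + d *+ j)%R | j in iota 0 #|` B i|].
  move=> /inBs iBs; apply: prog_arc => //; [exact: aBs|exact/ltnW/Bs2|].
  exact: lt_pGW (card_setpart_mem ltS tight dA pBs iBs) ltS.
have [s sP] := finite_choice 0 exs.
(* Only [al i + be i = s i] matters, so the chaining condition
   [al i.+1 = - be i] is met by solving for [al] recursively. *)
pose al := fix al i := if i is i'.+1 then al i' - s i' else 0.
exists d, B, al, (fun i => s i - al i); split.
- move=> i il; split; last exact/Bs2/inBs.
  apply/fsubsetP => a aB; rewrite -mult_gt0.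
  by have := multBs a; rewrite (big_rem (B i)) ?inBs //= aB; lia.
- split=> //; split=> [i il|i _]; last by rewrite /= opprB.
  split=> //; exists #|` B i|; split; first exact/ltnW/Bs2/inBs.
  rewrite {1}sP //; apply: eq_imfset => // j.
  by rewrite addrAC [al i + _]addrC subrK.
- by move=> a _; rewrite muE -multBs {1}BsE big_mkseq.
- by rewrite (bigsum_sumset B) -BsE.
Qed.

End Minimizing.

Theorem theorem5p8 (G : zmodType) (l m : nat) (A : 'I_m -> {fset G})
  (hl : (2 <= l)%N) (hlm : (l < m)%N)
  (hA : forall i : 'I_m, (2 <= #|` A i|)%N)
  (hsmall : if l == 2%N then lt_pG G (#|` Sigma l A|).+1 else lt_pG G #|` Sigma l A|) :
  ((#|` Sigma l A| + l = (\sum_(a <- Aunion A) mu l A a) + 1)%N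
     <-> exists d : G, minimizing l d A)
  /\ ((#|` Sigma l A| + l = (\sum_(a <- Aunion A) mu l A a) + 1)%N ->
      (l = 2%N -> forall i : 'I_m, exists d : G, is_AP (A i `|` Mset l A) d)
      /\ ((3 <= l)%N -> exists d : G,
            is_AP (Aunion A) d /\ forall i : 'I_m, is_AP (A i `|` Mset l A) d)).
Proof.
have l0 : (0 < l)%N by apply: ltnW.
(* The bound for [l = 2] implies the general one; both are kept, since Vosper's theorem on exactly
   two sets needs the stronger. *)
have ltS : lt_pG G #|` Sigma l A|.
  by case: ifP hsmall => // _; apply: lt_pGW.
have ltS2 : l = 2%N -> lt_pG G #|` Sigma l A|.+1.
  by move=> l2; move: hsmall; rewrite l2.
split; first split=> [tight|[d]].
- exact: tight_minimizing.
- exact: minimizing_tight.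
move=> tight; split=> [l2|l3].
  exact: is_AP_AiM2.
exact: is_AP_AiM.
Qed.
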